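(* Let $N_B$ be any subset of the positive integers, let $\rho_n=1$ if $n\in N_B$ and $\rho_n=2$ if $n\notin N_B$, and let $q_{i,n}$ ($n\ge1$, $0\le i\le m_n$, with $m_n\in\mathbb N\cup\{0,+\infty\}$, where $i$ ranges over all nonnegative integers if $m_n=+\infty$) be real numbers such that $q_{i,n}>0$ for all $i,n$; $\sum_{i=0}^{m_n}q_{i,n}=1$ for all $n$; and $\prod_{n=1}^{\infty}q_{i_n,n}=0$ for every admissible digit sequence $(i_n)$. Consider the sign-variable $\tilde Q$-expansion $$x=\Delta^{(\pm\tilde Q,N_B)}_{i_1i_2\ldots i_n\ldots}=(-1)^{\rho_1}a_{i_1,1}+\sum_{n=2}^{\infty}\Big((-1)^{\rho_n}a_{i_n,n}\prod_{j=1}^{n-1}q_{i_j,j}\Big).$$ Then for every positive integer $m$ the generalized shift operator $\sigma_m$ is a piecewise linear function, i.e. for every choice of admissible digits $c_1,\ldots,c_m$ there are real constants $\alpha,\beta$ such that $\sigma_m(x)=\alpha x+\beta$ for all $x=\Delta^{(\pm\tilde Q,N_B)}_{c_1\ldots c_m i_{m+1}i_{m+2}\ldots}$ whose first $m$ digits are $c_1,\ldots,c_m$.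
   Context: An admissible digit sequence is a sequence $(i_n)_{n\ge1}$ of nonnegative integers with $i_n\le m_n$ for all $n$ (no upper bound if $m_n=+\infty$). The coefficients are $a_{i_n,n}=\sum_{i=0}^{i_n-1}q_{i,n}$ if $i_n\ne0$ and $a_{0,n}=0$. The generalized shift operator $\sigma_m$ deletes the $m$-th digit together with the $m$-th column (the data $q_{i,m}$ and the sign $\rho_m$), so that for $x=\Delta^{(\pm\tilde Q,N_B)}_{i_1i_2\ldots}$ $$\sigma_m(x)=\sum_{n=1}^{m-1}\Big((-1)^{\rho_n}a_{i_n,n}\prod_{j=1}^{n-1}q_{i_j,j}\Big)+\sum_{l=m+1}^{\infty}\Big((-1)^{\rho_l}a_{i_l,l}\prod_{\substack{1\le j\le l-1\\ j\ne m}}q_{i_j,j}\Big),$$ with empty products equal to $1$ and empty sums equal to $0$. The operator is evaluated on a given expansion (digit sequence) of $x$. ''Piecewise linear'' means linear in the affine sense on each piece, the pieces being the sets (cylinders of rank $m$) of all $x$ given by expansions with fixed first $m$ digits $c_1,\ldots,c_m$. *)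

(* Defs.v *)
From HB Require Import structures.
From mathcomp Require Import all_boot all_order all_algebra.
From mathcomp Require Import all_classical all_reals.
From mathcomp Require Import topology normedtype sequences.

Set Implicit Arguments.
Unset Strict Implicit.
Unset Printing Implicit Defensive.

Import Order.TTheory GRing.Theory Num.Theory.
Import numFieldNormedType.Exports.

Local Open Scope classical_set_scope.
Local Open Scope ring_scope.

(* All sequences indexed by n >= 1 are represented by functions on nat whose
   value at 0 is irrelevant.  The column bound m_n is M n : option nat, where
   None stands for +oo. *)

Definition valid_digit (M : nat -> option nat) (n d : nat) : bool :=
  if M n is Some k then (d <= k)%N else true.

Definition admissible (M : nat -> option nat) (i : nat -> nat) : Prop :=
  forall n : nat, (0 < n)%N -> valid_digit M n (i n).

(* q i n is q_{i,n}: the digit comes first, the column second.  Entries with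
   i > m_n are junk. *)
Definition column_sum_one (R : realType) (M : nat -> option nat)
    (q : nat -> nat -> R) (n : nat) : Prop :=
  match M n with
  | Some k => \sum_(0 <= i < k.+1) q i n = 1
  | None => (fun N : nat => \sum_(0 <= i < N) q i n) @ \oo --> (1 : R)
  end.

Definition rho (NB : set nat) (n : nat) : nat := if n \in NB then 1%N else 2%N.

Definition coef (R : realType) (q : nat -> nat -> R) (d n : nat) : R :=
  \sum_(0 <= i < d) q i n.

(* In the next two definitions the infinite sums are limits of partial sums.
   They exist when the q_{i,n} are positive with columns summing to 1, as
   coef q d n + q d n <= 1 bounds the absolute partial sums by a telescoping
   sum. *)
Definition Delta (R : realType) (NB : set nat) (q : nat -> nat -> R)
    (i : nat -> nat) : R :=
  (-1) ^+ rho NB 1%N * coef q (i 1%N) 1%N +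
  \big[+%R/0]_(2 <= n <oo)
    ((-1) ^+ rho NB n * coef q (i n) n * \prod_(1 <= j < n) q (i j) j).

(* The shift acts on digit sequences, since a number may have several
   expansions. *)
Definition shift_op (R : realType) (NB : set nat) (q : nat -> nat -> R)
    (m : nat) (i : nat -> nat) : R :=
  \sum_(1 <= n < m)
    ((-1) ^+ rho NB n * coef q (i n) n * \prod_(1 <= j < n) q (i j) j) +
  \big[+%R/0]_(m.+1 <= l <oo)
    ((-1) ^+ rho NB l * coef q (i l) l *
     \prod_(1 <= j < l | j != m) q (i j) j).

(* Main.v *)
Require Import Defs.
From HB Require Import structures.
From mathcomp Require Import all_boot all_order all_algebra.
From mathcomp Require Import all_classical all_reals.
From mathcomp Require Import topology normedtype sequences.

Set Implicit Arguments.
Unset Strict Implicit.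
Unset Printing Implicit Defensive.

Import Order.TTheory GRing.Theory Num.Theory.
Import numFieldNormedType.Exports.

Local Open Scope classical_set_scope.
Local Open Scope ring_scope.

(** Fix the digit sequence i.  In each term of the shifted series beyond the
    m-th, deleting the m-th digit only removes the factor q (i m) m from the
    product, so the tail of the shifted series is the tail of the original one
    divided by q (i m) m ([prod_nat_skip], [shift_opE]).  On a cylinder of rank
    m this factor, the terms of index below m of the shifted series and the
    terms of index at most m of the original one depend only on the fixed
    digits ([eq_Delta_term]).  Hence the shift is affine there, with slope
    1 / q (c m) m.

    Since infinite sums are limits of partial sums, the tail can be compared
    with the whole series only once the latter is known to converge.  The
    column condition gives coef q d n + q d n <= 1 ([coefS_le1]), so that the
    n-th term of the series is bounded by the difference of two consecutive
    products of the q (i j) j, and these differences telescope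
    ([cvg_signed_sum], [cvg_Delta]). *)

Lemma cvg_sum_tail (R : realType) (u : nat -> R) (k m : nat) (l : R) :
  (k <= m)%N ->
  (fun N : nat => \sum_(k <= n < N) u n) @ \oo --> l ->
  (fun N : nat => \sum_(m <= n < N) u n) @ \oo --> l - \sum_(k <= n < m) u n.
Proof.
move=> km ul; set a := \sum_(k <= n < m) u n.
apply: cvg_trans (cvgB ul (cvg_cst a)); apply: near_eq_cvg.
near=> N; have mN : (m <= N)%N by near: N; exact: nbhs_infty_ge.
by rewrite !fctE (big_cat_nat km mN)/= -/a addrC addKr.
Unshelve. all: by end_near. Qed.

(** The left-hand side is the sum of the first d + 1 entries of a column of
    positive numbers with total 1. *)
Lemma coefS_le1 (R : realType) (M : nat -> option nat) (q : nat -> nat -> R)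
    (n d : nat) :
  (forall i : nat, valid_digit M n i -> 0 < q i n) ->
  column_sum_one M q n -> valid_digit M n d -> coef q d n + q d n <= 1.
Proof.
move=> q_gt0; rewrite /column_sum_one /coef => q1 vd.
rewrite -big_nat_recr//=.
move: q_gt0 q1 vd; rewrite /valid_digit; case: (M n) => [k|] q_gt0 q1 dk.
  rewrite -q1 [leRHS](@big_cat_nat _ _ _ d.+1)//= lerDl big_nat sumr_ge0// => j.
  by rewrite ltnS => /andP[_ jk]; rewrite ltW// q_gt0.
rewrite -(cvg_lim (@Rhausdorff R) q1).
apply: (nondecreasing_cvgn_le (u_ := fun N => \sum_(0 <= i < N) q i n)).
  apply/nondecreasing_seqP => N.
  by rewrite big_nat_recr//= lerDl ltW// q_gt0.
by apply/cvg_ex; exists 1.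
Qed.

(** With P n the product of the first n factors p, the inequality
    a n + p n <= 1 bounds the n-th term in absolute value by P n.-1 - P n.
    Hence the absolute partial sums telescope to at most P 0 = 1. *)
Lemma cvg_signed_sum (R : realType) (s : nat -> nat) (a p : nat -> R) :
  (forall n, (0 < n)%N -> 0 <= a n) -> (forall n, (0 < n)%N -> 0 < p n) ->
  (forall n, (0 < n)%N -> a n + p n <= 1) ->
  cvgn (fun N : nat =>
    \sum_(1 <= n < N) ((-1) ^+ s n * a n * \prod_(1 <= j < n) p j)).
Proof.
move=> a_ge0 p_gt0 ap1.
pose T n := (-1) ^+ s n * a n * \prod_(1 <= j < n) p j.
pose P n := \prod_(1 <= j < n.+1) p j.
have P_ge0 n : 0 <= P n.
  by rewrite /P big_nat prodr_ge0// => j /andP[j0 _]; exact/ltW/p_gt0.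
(* The library's series start at index 0, hence the shift of index. *)
pose u n := T n.+1.
have u_le n : `|u n| <= P n - P n.+1.
  rewrite /u /T normrM normrM normrX normrN1 expr1n mul1r.
  rewrite (ger0_norm (a_ge0 _ _))// (ger0_norm (P_ge0 n)).
  rewrite [P n.+1]big_nat_recr//= -/(P n) -[X in X - _]mulr1 -mulrBr mulrC.
  by apply: ler_wpM2l => //; rewrite lerBrDr ap1.
have : cvgn (series u).
  apply: normed_cvg; apply: nondecreasing_is_cvgn.
    by apply: nondecreasing_series => n _ _; exact: normr_ge0.
  exists 1 => _ [N _ <-]; rewrite /= /series/=.
  have le_tel : \sum_(0 <= n < N) `|u n| <= \sum_(0 <= n < N) (P n - P n.+1).
    by apply: ler_sum => n _.
  rewrite (le_trans le_tel)// (@telescope_sumr_eq _ 0 N (fun n => - P n))//.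
    by rewrite opprK {2}/P big_geq// addrC lerBlDr lerDl.
  by move=> n _; rewrite opprK addrC.
move=> /cvg_ex[l ul]; apply/cvg_ex; exists l.
rewrite -cvg_shiftS; apply: cvg_trans ul; apply: near_eq_cvg.
by near=> N; rewrite seriesEnat/= big_add1.
Unshelve. all: by end_near. Qed.


Definition Delta_term (R : realType) (NB : set nat) (q : nat -> nat -> R)
    (i : nat -> nat) (n : nat) : R :=
  (-1) ^+ rho NB n * coef q (i n) n * \prod_(1 <= j < n) q (i j) j.

(** The first summand of Delta is the term of index 1, whose product is empty,
    so Delta is the sum of a single series from 1 on. *)
Lemma cvg_Delta (R : realType) (NB : set nat) (M : nat -> option nat)
    (q : nat -> nat -> R) (i : nat -> nat) :
  (forall n d : nat, (0 < n)%N -> valid_digit M n d -> 0 < q d n) ->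
  (forall n : nat, (0 < n)%N -> column_sum_one M q n) ->
  admissible M i ->
  (fun N : nat => \sum_(1 <= n < N) Delta_term NB q i n) @ \oo --> Delta NB q i.
Proof.
move=> q_gt0 q_sum adm.
have coef_ge0 n : (0 < n)%N -> 0 <= coef q (i n) n.
  move=> n0; rewrite /coef big_nat sumr_ge0// => j /andP[_ ji].
  apply/ltW/q_gt0 => //; have := adm n n0; rewrite /valid_digit.
  by case: (M n) => // k; apply: leq_trans; exact: ltnW.
have cD : cvgn (fun N : nat => \sum_(1 <= n < N) Delta_term NB q i n).
  apply: (cvg_signed_sum (a := fun n => coef q (i n) n)
    (p := fun n => q (i n) n)) => // n n0; first exact: q_gt0 (adm n n0).
  by apply: coefS_le1 (q_sum n n0) (adm n n0) => d; exact: q_gt0.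
have tail := cvg_sum_tail (leqnSn 1) cD.
suff -> : Delta NB q i = limn (fun N => \sum_(1 <= n < N) Delta_term NB q i n) by [].
rewrite /Delta (cvg_lim (@Rhausdorff R) tail) big_nat1 {2}/Delta_term big_geq// mulr1.
by rewrite addrC subrK.
Qed.

Lemma prod_nat_skip (R : fieldType) (F : nat -> R) (m l : nat) :
  (0 < m < l)%N -> F m != 0 ->
  \prod_(1 <= j < l | j != m) F j = (F m)^-1 * \prod_(1 <= j < l) F j.
Proof.
move=> ml Fm; rewrite [in RHS](bigD1_seq m)/= ?iota_uniq ?mem_index_iota//.
by rewrite mulKf.
Qed.

Lemma eq_Delta_term (R : realType) (NB : set nat) (q : nat -> nat -> R)
    (m n : nat) (i c : nat -> nat) :
  (forall j : nat, (0 < j <= m)%N -> i j = c j) -> (0 < n <= m)%N ->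
  Delta_term NB q i n = Delta_term NB q c n.
Proof.
move=> ic nm; rewrite /Delta_term ic//; congr (_ * _).
rewrite !big_nat; apply: eq_bigr => j /andP[j0 jn].
have /andP[_ n_le_m] := nm.
by rewrite ic// j0 (leq_trans (ltnW jn)).
Qed.

(** The affine relation on a single digit sequence: its coefficients involve
    only the first m digits. *)
Lemma shift_opE (R : realType) (NB : set nat) (M : nat -> option nat)
    (q : nat -> nat -> R) (m : nat) (i : nat -> nat) :
  (forall n d : nat, (0 < n)%N -> valid_digit M n d -> 0 < q d n) ->
  (forall n : nat, (0 < n)%N -> column_sum_one M q n) ->
  (0 < m)%N -> admissible M i ->
  shift_op NB q m i = \sum_(1 <= n < m) Delta_term NB q i n +
    (q (i m) m)^-1 * (Delta NB q i - \sum_(1 <= n < m.+1) Delta_term NB q i n).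
Proof.
move=> q_gt0 q_sum m0 adm; rewrite /shift_op; congr (_ + _).
apply: (cvg_lim (@Rhausdorff R)).
have tail := cvg_sum_tail (ltn0Sn m) (cvg_Delta (NB := NB) q_gt0 q_sum adm).
apply: cvg_trans (cvgMl_tmp (a := (q (i m) m)^-1) tail).
apply: near_eq_cvg; apply: nearW => N.
rewrite mulr_sumr !big_nat; apply: eq_bigr => l /andP[ml _].
rewrite prod_nat_skip ?m0//; last by rewrite gt_eqF// q_gt0// adm.
by rewrite /Delta_term mulrCA.
Qed.
Theorem mainTheorem2 (R : realType) (NB : set nat) (M : nat -> option nat)
    (q : nat -> nat -> R)
    (hNB : NB `<=` [set n : nat | (0 < n)%N])
    (q_gt0 : forall n i : nat, (0 < n)%N -> valid_digit M n i -> 0 < q i n)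
    (q_sum : forall n : nat, (0 < n)%N -> column_sum_one M q n)
    (q_prod : forall i : nat -> nat, admissible M i ->
       (fun N : nat => \prod_(1 <= n < N.+1) q (i n) n) @ \oo --> (0 : R))
    (m : nat) (hm : (0 < m)%N)
    (c : nat -> nat)
    (hc : forall n : nat, (0 < n <= m)%N -> valid_digit M n (c n)) :
  exists alpha beta : R,
    forall i : nat -> nat, admissible M i ->
      (forall n : nat, (0 < n <= m)%N -> i n = c n) ->
      shift_op NB q m i = alpha * Delta NB q i + beta.
Proof.
exists (q (c m) m)^-1, (\sum_(1 <= n < m) Delta_term NB q c n -
  (q (c m) m)^-1 * \sum_(1 <= n < m.+1) Delta_term NB q c n) => i adm ic.
have eq_sum k : (k <= m.+1)%N ->
    \sum_(1 <= n < k) Delta_term NB q i n = \sum_(1 <= n < k) Delta_term NB q c n.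
  move=> km; rewrite !big_nat; apply: eq_bigr => n /andP[n0 nk].
  by apply: eq_Delta_term ic _; rewrite n0 -ltnS (leq_trans nk).
rewrite (shift_opE NB q_gt0 q_sum hm adm) !eq_sum// ic ?hm ?leqnn//.
by rewrite mulrBr addrCA.
Qed.
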